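(* Let $S_0,V_0,K>0$. Then for every $\rho\in(-1,1)$, $$\mathcal{I}_\rho(S_0,V_0,K)\le\frac{1}{1-\rho^2}\,\mathcal{J}\left(V_0,\frac{K}{\eta^2(S_0)}\right),$$ with $\mathcal{I}_\rho$ and $\mathcal{J}$ as defined in the context.
   Context: Let $\eta,\sigma:(0,\infty)\to(0,\infty)$ be (Borel measurable) functions. For $\rho\in(-1,1)$ and absolutely continuous $g,h:[0,1]\to\mathbb{R}$ set $$\Lambda_\rho[g,h]=\frac{1}{2(1-\rho^2)}\int_0^1\left(\frac{g'(t)}{\eta(e^{g(t)})\sqrt{e^{h(t)}}}-\frac{\rho h'(t)}{\sigma(e^{h(t)})}\right)^2dt+\frac12\int_0^1\left(\frac{h'(t)}{\sigma(e^{h(t)})}\right)^2dt,$$ and let $$\mathcal{I}_\rho(S_0,V_0,K)=\inf\left\{\Lambda_\rho[g,h]:\ g(0)=\log S_0,\ h(0)=\log V_0,\ \int_0^1e^{h(t)}\eta^2(e^{g(t)})\,dt=K\right\}.$$ For $z>0$, $$\mathcal{J}(V_0,z)=\inf\left\{\frac12\int_0^1\left(\frac{h'(t)}{\sigma(e^{h(t)})}\right)^2dt:\ h\text{ absolutely continuous on }[0,1],\ h(0)=\log V_0,\ \int_0^1e^{h(t)}dt=z\right\}.$$ *)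

(* Defs.v *)
(* MathComp-Analysis; the reals are an arbitrary [R : realType]. *)
From HB Require Import structures.
From mathcomp Require Import all_boot all_order all_algebra.
From mathcomp Require Import all_classical all_reals all_analysis.
Import Order.TTheory GRing.Theory Num.Theory.
Import numFieldNormedType.Exports.

Set Implicit Arguments.
Unset Strict Implicit.
Unset Printing Implicit Defensive.

Local Open Scope classical_set_scope.
Local Open Scope ring_scope.

Definition absolutely_continuous (R : realType) (a b : R) (f : R -> R) : Prop :=
  forall e : R, 0 < e -> exists2 d : R, 0 < d &
    forall (n : nat) (x y : 'I_n -> R),
      (forall i, a <= x i /\ x i < y i /\ y i <= b) ->
      trivIset [set: 'I_n] (fun i => `]x i, y i[%classic) ->
      \sum_(i < n) (y i - x i) < d ->
      \sum_(i < n) `|f (y i) - f (x i)| < e.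

(* Paths on [0,1] are represented by functions on R of which only the
   restriction to [0,1] matters. An absolutely continuous path is
   differentiable almost everywhere on [0,1]; elsewhere in [0,1] (including
   possibly at the end points) [derive1 f] takes an unspecified value, which does
   not affect the integrals. Integrands below are nonnegative and integrals
   take values in [0,+oo]. *)

Definition rate_function (R : realType) (eta sigma : R -> R) (rho : R)
    (g h : R -> R) : \bar R :=
  ((1 / (2 * (1 - rho ^+ 2)))%:E *
     \int[@lebesgue_measure R]_(t in `[0%R, 1%R])
       ((derive1 g t / (eta (expR (g t)) * Num.sqrt (expR (h t)))
         - rho * derive1 h t / sigma (expR (h t))) ^+ 2)%:E
   + (1 / 2)%:E *
     \int[@lebesgue_measure R]_(t in `[0%R, 1%R])
       ((derive1 h t / sigma (expR (h t))) ^+ 2)%:E)%E.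

(* The infima are taken in [\bar R], so the infimum over an empty set of
   admissible paths is +oo. *)

Definition Irate (R : realType) (eta sigma : R -> R) (rho S0 V0 K : R) : \bar R :=
  ereal_inf [set l : \bar R | exists g h : R -> R,
    [/\ absolutely_continuous 0 1 g /\ absolutely_continuous 0 1 h,
        g 0 = ln S0 /\ h 0 = ln V0,
        (\int[@lebesgue_measure R]_(t in `[0%R, 1%R])
           (expR (h t) * eta (expR (g t)) ^+ 2)%:E)%E = K%:E
      & l = rate_function eta sigma rho g h]].

Definition Jrate (R : realType) (sigma : R -> R) (V0 z : R) : \bar R :=
  ereal_inf [set l : \bar R | exists h : R -> R,
    [/\ absolutely_continuous 0 1 h,
        h 0 = ln V0,
        (\int[@lebesgue_measure R]_(t in `[0%R, 1%R]) (expR (h t))%:E)%E = z%:E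
      & l = ((1 / 2)%:E *
             \int[@lebesgue_measure R]_(t in `[0%R, 1%R])
               ((derive1 h t / sigma (expR (h t))) ^+ 2)%:E)%E]].

(* Main.v *)
(* Freezing the asset path at g = log S0 makes h admissible for I_rho as soon
   as it is admissible for J at level K / eta(S0)^2; since g' = 0, the rate is
   then (rho^2 / (1 - rho^2) + 1) / 2 = 1 / (2 (1 - rho^2)) times the integral
   of (h' / sigma(e^h))^2. *)
Require Import Defs.
From HB Require Import structures.
From mathcomp Require Import all_boot all_order all_algebra.
From mathcomp Require Import all_classical all_reals all_analysis.
From mathcomp Require Import ring lra.
Import Order.TTheory GRing.Theory Num.Theory.
Import numFieldNormedType.Exports.
Local Open Scope classical_set_scope.
Local Open Scope ring_scope.

Import HBNNSimple.

(* Unlike [ge0_integralZl], this does not ask [f] to be measurable, so that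
   nothing has to be proved about the derivative of an absolutely continuous
   path: scaling by [k] is a bijection between the simple functions below [f]
   and those below [k f]. *)
Lemma ge0_integralZl_nonmeasurable {d} {T : measurableType d} {R : realType}
    (mu : {measure set T -> \bar R}) (D : set T) (f : T -> \bar R) (k : R) :
  (forall x, D x -> (0 <= f x)%E) -> 0 <= k ->
  (\int[mu]_(x in D) (k%:E * f x) = k%:E * \int[mu]_(x in D) f x)%E.
Proof.
move=> f0; rewrite le_eqVlt => /predU1P[<-|k0].
  (* Scaling by [k = 0] has no inverse, but both sides vanish, as [0 * +oo = 0]. *)
  by rewrite mul0e; apply: integral0_eq => x _; rewrite mul0e.
have ki0 : 0 < k^-1 by rewrite invr_gt0.
rewrite !ge0_integralE//; last by move=> x /f0; apply: mule_ge0; exact: ltW.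
rewrite erestrict_scale -ereal_sup_pZl//; congr ereal_sup.
apply/seteqP; split=> [_ [h hf <-]|_ [_ [h hf <-] <-]].
- exists (sintegral mu (scale_nnsfun h (ltW ki0))).
    exists (scale_nnsfun h (ltW ki0)) => //= x.
    by rewrite EFinM lee_pdivrMl.
  by rewrite (sintegralrM mu k^-1 h) muleA -EFinM divff ?gt_eqF// mul1e.
- exists (scale_nnsfun h (ltW k0)); last exact: sintegralrM.
  by move=> x /=; rewrite EFinM lee_pmul2l ?fin_numE// hf.
Qed.

Lemma absolutely_continuous_cst {R : realType} (a b c : R) :
  absolutely_continuous a b (cst c).
Proof.
move=> e e0; exists 1 => // n x y _ _ _.
by rewrite big1// => i _; rewrite subrr normr0.
Qed.

Lemma rate_function_cst {R : realType} (eta sigma : R -> R) (rho c : R)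
    (h : R -> R) : -1 < rho -> rho < 1 ->
  rate_function eta sigma rho (cst c) h =
  ((1 / (1 - rho ^+ 2))%:E * ((1 / 2)%:E *
     \int[@lebesgue_measure R]_(t in `[0%R, 1%R])
       ((derive1 h t / sigma (expR (h t))) ^+ 2)%:E))%E.
Proof.
move=> rhoN1 rho1; rewrite /rate_function.
have rho2 : 0 < 1 - rho ^+ 2 by nra.
set A := (X in (_ = _ * (_ * X))%E).
have -> : (\int[@lebesgue_measure R]_(t in `[0%R, 1%R])
    ((derive1 (cst c) t / (eta (expR (cst c t)) * Num.sqrt (expR (h t)))
      - rho * derive1 h t / sigma (expR (h t))) ^+ 2)%:E = (rho ^+ 2)%:E * A)%E.
  rewrite -ge0_integralZl_nonmeasurable ?sqr_ge0//; last first.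
    by move=> x _; rewrite lee_fin sqr_ge0.
  apply: eq_integral => t _.
  by rewrite derive1_cst mul0r sub0r sqrrN -mulrA exprMn EFinM.
have A0 : (0 <= A)%E by apply: integral_ge0 => t _; rewrite lee_fin sqr_ge0.
(* [A] may be [+oo]: its two coefficients are merged using that both are nonnegative. *)
rewrite !muleA -!EFinM -ge0_muleDl ?lee_fin//; last first.
  by rewrite mulr_ge0 ?sqr_ge0// divr_ge0// mulr_ge0// ltW.
by rewrite -EFinD; congr (_%:E * _)%E; field; rewrite gt_eqF.
Qed.

Theorem proposition13 (R : realType) (eta sigma : R -> R)
  (eta_pos : forall x : R, 0 < x -> 0 < eta x)
  (sigma_pos : forall x : R, 0 < x -> 0 < sigma x)
  (eta_meas : measurable_fun (`]0, +oo[%classic : set R) eta)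
  (sigma_meas : measurable_fun (`]0, +oo[%classic : set R) sigma)
  (S0 V0 K : R) (S0_pos : 0 < S0) (V0_pos : 0 < V0) (K_pos : 0 < K)
  (rho : R) (rho_gtN1 : -1 < rho) (rho_lt1 : rho < 1) :
  (Irate eta sigma rho S0 V0 K
     <= (1 / (1 - rho ^+ 2))%:E * Jrate sigma V0 (K / eta S0 ^+ 2))%E.
Proof.
have rho2 : 0 < 1 / (1 - rho ^+ 2) by rewrite divr_gt0//; nra.
(* A positive finite factor moves inside the infimum, even over an empty set; it remains to bound
   [Irate] by each scaled cost. *)
rewrite /Jrate -ereal_inf_pZl//.
apply: le_ereal_inf_tmp => _ [_ [h [ach h0 hK ->]] <-].
apply: ereal_inf_lbound; exists (cst (ln S0)), h; split => //.
- by split=> //; exact: absolutely_continuous_cst.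
- have etaS0 : eta S0 != 0 by rewrite gt_eqF// eta_pos.
  (* Since [expR (ln S0) = S0], the factor [eta S0 ^+ 2] is constant in time and cancels the
     denominator of the level in [hK]. *)
  under eq_integral do rewrite /= lnK ?posrE// mulrC EFinM.
  rewrite ge0_integralZl_nonmeasurable ?sqr_ge0//.
  by rewrite hK -EFinM mulrC divfK// expf_neq0.
- by rewrite rate_function_cst.
Qed.
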